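(* For every fixed $d\ge1$, \[\frac{6d^2-5d-1}{18}n^2+O(n)\le M^d(n)\le\frac{d^2}{2}n^2+O(n)\] as $n\to\infty$.
   Context: $[n]^d$ denotes the grid with vertex set $\{1,\dots,n\}^d$, two vertices adjacent iff at $\ell_1$-distance 1. In $2$-neighbour bootstrap percolation from $A_0=A$, $A_t=A_{t-1}\cup\{v: v\text{ has at least 2 neighbours in }A_{t-1}\}$; $A$ percolates if eventually all vertices are infected, and its percolation time $T^d(A)$ is the least $T$ with $A_T=[n]^d$. $M^d(n)$ is the maximum of $T^d(A)$ over all $A\subseteq[n]^d$ that percolate. *)

(* Defs.v *)
From HB Require Import structures.
From mathcomp Require Import all_boot all_order all_algebra.
From mathcomp Require Import boolp.

Set Implicit Arguments.
Unset Strict Implicit.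
Unset Printing Implicit Defensive.

(* Coordinates are numbered 0, ..., n-1 instead of 1, ..., n. *)
Definition grid (n d : nat) : finType := {ffun 'I_d -> 'I_n}.

Definition l1_dist (n d : nat) (u v : grid n d) : nat :=
  \sum_(i < d) `|u i - v i|%N.

Definition adjacent (n d : nat) (u v : grid n d) : bool := l1_dist u v == 1.

Definition infection_step (n d : nat) (A : {set grid n d}) : {set grid n d} :=
  A :|: [set v | 2 <= #|[set u in A | adjacent v u]|].

Definition infected (n d : nat) (A : {set grid n d}) (t : nat) :
    {set grid n d} :=
  iter t (@infection_step n d) A.

Definition percolates (n d : nat) (A : {set grid n d}) : Prop :=
  exists t, infected A t == [set: grid n d].

(* The value 0 for a non-percolating set is a dummy. *)
Definition percolation_time (n d : nat) (A : {set grid n d}) : nat :=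
  if pselect (percolates A) is left A_perc then ex_minn A_perc else 0.

Definition max_percolation_time (d n : nat) : nat :=
  \max_(A : {set grid n d} | `[< percolates A >]) percolation_time A.

(* Main.v *)
Require Import Defs.
From mathcomp Require Import all_boot all_order all_algebra zify lra ring.
From mathcomp Require Import boolp.

Set Implicit Arguments.
Unset Strict Implicit.
Unset Printing Implicit Defensive.

(** Upper bound.  If a box is full and a site next to it is infected, the box
lengthened by one layer is full after at most [s] more steps, [s] being the
diameter of the box.  Hence the union of the boxes of diameter [s] that are full
at time [1 + ... + s], [s] arbitrary, is closed under infection, and a box of
maximal diameter among them is the whole grid, of diameter [d (n - 1)].

Lower bound.  Start from a full box and let it grow by a sequence of single
sites, each one at distance 1 or 2 from the current box, at the corner which the
current box infects last, and at distance at least 3 from the previous box.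
Then the sites act one after the other, and a site that lengthens side [i] costs
the sum of the other sides, up to a constant.  The only constraint is that two
consecutive sites are not both at distance 1.  With sides [m_i], a pair of
steps [+2, +1] in the same direction costs 2/3 of the increase of
[sum_(i < j) m_i m_j], and a pair [+2] in direction [i], [+1] in direction [j]
gains [(m_i - m_j) / 3] more than that.  One lets side 0 start at [n / 3] and, for
each [j < d - 1], lengthens side [j] from [n / 3] to [n] while side [j + 1] goes
from 0 to [n / 3]; this gains [n^2 / 18] for each [j].  Side [d - 1] is then
completed with pairs in the same direction. *)

Lemma sum_change1 (I : finType) (F G : I -> nat) i :
  (forall k, k != i -> F k = G k) -> \sum_k F k + G i = \sum_k G k + F i.
Proof.
move=> FG; rewrite (bigD1 i) //= [in RHS](bigD1 i) //= (eq_bigr G) //.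
by rewrite addnC [in LHS](addnC (F i)) addnA.
Qed.

Section GridGeometry.
Variables n d : nat.
Implicit Types (u v w b : grid n d) (x : 'I_n) (i j k : 'I_d).
Implicit Types (A X Y : {set grid n d}).

Lemma l1_distC u v : l1_dist u v = l1_dist v u.
Proof. by apply: eq_bigr => i _; lia. Qed.

Lemma l1_dist_triangle v u w : l1_dist u w <= l1_dist u v + l1_dist v w.
Proof. by rewrite /l1_dist -big_split /=; apply: leq_sum => i _; lia. Qed.

Lemma l1_dist_eq0 u v : l1_dist u v = 0 -> u = v.
Proof.
move=> /eqP; rewrite sum_nat_eq0 => /forallP h.
by apply/ffunP => i; apply: ord_inj; move: (h i) => /implyP /(_ isT); lia.
Qed.

Lemma l1_dist_ge_coord k u v : `|u k - v k|%N <= l1_dist u v.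
Proof. by rewrite /l1_dist (bigD1 k) //= leq_addr. Qed.

Lemma l1_dist_ge_coord2 i j u v : i != j ->
  `|u i - v i|%N + `|u j - v j|%N <= l1_dist u v.
Proof.
move=> ij; rewrite /l1_dist (bigD1 i) //= (bigD1 j) 1?eq_sym //=; lia.
Qed.

Lemma adjacent_coordP v u : adjacent v u ->
  exists k, `|v k - u k|%N = 1 /\ forall j, j != k -> v j = u j.
Proof.
move=> /sum_nat_eq1 [k [_ vuk vu]]; exists k; split=> // j jk.
by apply: ord_inj; move: (vu j jk isT); lia.
Qed.

Definition set_coord w k (x : 'I_n) : grid n d :=
  [ffun j => if j == k then x else w j].

Lemma set_coord_same w k x : set_coord w k x k = x.
Proof. by rewrite ffunE eqxx. Qed.

Lemma set_coord_other w k x j : j != k -> set_coord w k x j = w j.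
Proof. by move=> /negbTE jk; rewrite ffunE jk. Qed.

Lemma adjacent_set_coord w k x :
  `|w k - x|%N = 1 -> adjacent w (set_coord w k x).
Proof.
move=> wx; apply/sum_nat_eq1; exists k; split=> // [|j jk _].
  by rewrite set_coord_same.
by rewrite set_coord_other //; lia.
Qed.

Lemma l1_dist_set_coord w k x v :
  l1_dist (set_coord w k x) v + `|w k - v k|%N = l1_dist w v + `|x - v k|%N.
Proof.
have := @sum_change1 _ (fun j => `|set_coord w k x j - v j|%N)
  (fun j => `|w j - v j|%N) k.
rewrite /= set_coord_same => -> // j jk.
by rewrite set_coord_other.
Qed.

Lemma ord_step_toward (a b : 'I_n) : a != b ->
  exists x : 'I_n, `|a - x|%N = 1 /\ `|x - b|%N.+1 = `|a - b|%N.
Proof.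
move=> ab; have ab' : (a : nat) <> b by move=> e; case/eqP: ab; exact: ord_inj.
have [lt|le] := ltnP a b.
  have an : a.+1 < n by exact: leq_ltn_trans lt (ltn_ord b).
  by exists (Ordinal an) => /=; lia.
have an : a.-1 < n by have := ltn_ord a; lia.
by exists (Ordinal an) => /=; lia.
Qed.

Lemma infection_stepP A w :
  reflect (w \in A \/ exists u1 u2,
             [/\ u1 \in A, u2 \in A, adjacent w u1, adjacent w u2 & u1 != u2])
          (w \in infection_step A).
Proof.
rewrite !inE; apply: (iffP orP) => -[wA|h]; try by left.
  right; case/card_gt1P: h => u1 [u2 []]; rewrite !inE.
  by move=> /andP [? ?] /andP [? ?] ?; exists u1, u2.
right; apply/card_gt1P; case: h => u1 [u2 [? ? ? ? ?]].
by exists u1, u2; rewrite !inE; split => //; apply/andP.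
Qed.

Lemma infectedS A t : infected A t.+1 = infection_step (infected A t).
Proof. by []. Qed.

Lemma infectedD A s t : infected A (s + t) = infected (infected A s) t.
Proof. by rewrite /infected addnC iterD. Qed.

Lemma infection_stepS X Y : X \subset Y ->
  infection_step X \subset infection_step Y.
Proof.
move=> /subsetP XY; apply/subsetP => w /infection_stepP [wX|].
  by apply/infection_stepP; left; exact: XY.
move=> [u1 [u2 [? ? ? ? ?]]]; apply/infection_stepP; right.
by exists u1, u2; split => //; exact: XY.
Qed.

Lemma infected_mono A s t : s <= t -> infected A s \subset infected A t.
Proof.
move=> /subnKC <-; elim: (t - s) => [|k IH]; first by rewrite addn0.
by rewrite addnS infectedS (subset_trans IH) // subsetUl.
Qed.

Lemma infected_sub_closed A X t : A \subset X ->
  infection_step X \subset X -> infected A t \subset X.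
Proof.
move=> AX cX; elim: t => [//|t IH]; rewrite infectedS.
exact: subset_trans (infection_stepS IH) cX.
Qed.

Definition box (lo hi : 'I_d -> nat) : {set grid n d} :=
  [set w : grid n d | [forall k, lo k <= w k <= hi k]].

Lemma boxP lo hi w : reflect (forall k, lo k <= w k <= hi k) (w \in box lo hi).
Proof. by rewrite inE; exact: forallP. Qed.

Lemma notin_boxP lo hi w : w \notin box lo hi ->
  exists k, ~~ (lo k <= w k <= hi k).
Proof. by rewrite inE => /forallPn. Qed.

Lemma box_neighbor_unique lo hi w u1 u2 : w \notin box lo hi ->
  u1 \in box lo hi -> u2 \in box lo hi -> adjacent w u1 -> adjacent w u2 ->
  u1 = u2.
Proof.
move=> /notin_boxP [k wk] /boxP u1B /boxP u2B.
move=> /adjacent_coordP [k1 [e1 h1]] /adjacent_coordP [k2 [e2 h2]].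
have ? : k1 = k.
  by apply/eqP; apply: contraT; rewrite eq_sym => /h1 e; case/negP: wk; rewrite e.
have ? : k2 = k.
  by apply/eqP; apply: contraT; rewrite eq_sym => /h2 e; case/negP: wk; rewrite e.
subst k1 k2; apply/ffunP => j; have [->|jk] := eqVneq j k.
  by apply: ord_inj; move: (u1B k) (u2B k) wk e1 e2; lia.
by rewrite -h1 // -h2.
Qed.

Lemma layer_infected A t lo hi b v i r w :
  box lo hi \subset infected A t -> v \in infected A t ->
  b \in box lo hi -> `|v i - b i|%N = 1 ->
  (forall k, k != i -> v k = b k) -> ~~ (lo i <= v i <= hi i) ->
  w i = v i -> (forall k, k != i -> lo k <= w k <= hi k) ->
  l1_dist w v <= r -> w \in infected A (t + r).
Proof.
move=> /subsetP Bt vt /boxP bB vbi vb viB; elim: r w => [|r IH] w wi wB wr.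
  have -> : w = v by apply: l1_dist_eq0; lia.
  by rewrite addn0.
have [->|wv] := eqVneq w v.
  by apply: (subsetP (infected_mono A _)) vt; lia.
have [k wvk] : exists k, w k != v k.
  by apply/existsP; rewrite -negb_forall; apply: contra wv => /forallP h;
     apply/eqP/ffunP => k; exact/eqP/h.
have ki : k != i by apply: contraNneq wvk => ->; rewrite wi.
have [x [wx xv]] := ord_step_toward wvk.
rewrite addnS infectedS; apply/infection_stepP; right.
exists (set_coord w k x), (set_coord w i (b i)); split.
- apply: IH => [|j ji|].
  + by rewrite set_coord_other // eq_sym.
  + have [->|jk] := eqVneq j k; last by rewrite set_coord_other // wB.
    by rewrite set_coord_same; move: (bB k) (wB k ki); rewrite -vb //; lia.
  + by have := l1_dist_set_coord w k x v; lia.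
- apply: (subsetP (infected_mono A _)) (Bt _ _); first by lia.
  apply/boxP => j; have [->|ji] := eqVneq j i; last by rewrite set_coord_other // wB.
  by rewrite set_coord_same.
- exact: adjacent_set_coord.
- by apply: adjacent_set_coord; rewrite wi.
apply: contraNneq wvk => /ffunP /(_ k).
by rewrite set_coord_same set_coord_other // => e; move: wx; rewrite e; lia.
Qed.

Definition diam (lo hi : 'I_d -> nat) := \sum_k (hi k - lo k).

Lemma box_grow A t lo hi b v :
  box lo hi \subset infected A t -> v \in infected A t ->
  b \in box lo hi -> adjacent v b ->
  box (fun k => minn (lo k) (v k)) (fun k => maxn (hi k) (v k))
    \subset infected A (t + diam lo hi).
Proof.
move=> Bt vt bB vb; apply/subsetP => w /boxP wH'.
have wH k : minn (lo k) (v k) <= w k <= maxn (hi k) (v k) by exact: wH'.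
have [wB|] := boolP (w \in box lo hi).
  by apply: (subsetP (infected_mono A _)) (subsetP Bt _ wB); lia.
move=> /notin_boxP [i0 wi0]; move: (boxP _ _ _ bB) => bB'.
have [i [vbi vbj]] := adjacent_coordP vb.
have e : i0 = i.
  apply/eqP; apply: contraT => /vbj e.
  by move: (wH i0) (bB' i0) wi0; rewrite e; lia.
rewrite e in wi0 => {i0 e}.
have wi : (w i : nat) = v i by move: (wH i) (bB' i) wi0; lia.
have wB k : k != i -> lo k <= w k <= hi k.
  by move=> /vbj e; move: (wH k) (bB' k); rewrite e; lia.
apply: (@layer_infected A t lo hi b v i) => //.
- by rewrite -wi.
- exact: ord_inj.
apply: leq_sum => k _; have [->|ki] := eqVneq k i; first by rewrite wi; lia.
by move: (wB k ki) (bB' k); rewrite (vbj k ki); lia.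
Qed.

Section UpperBound.
Variable A : {set grid n d}.

(* A box of diameter s is timely if it is full after 1 + 2 + ... + s steps. *)
Definition timely_box lo hi :=
  (forall k, lo k <= hi k < n) /\
  box lo hi \subset infected A 'C((diam lo hi).+1, 2).

Lemma diam_le lo hi : (forall k, lo k <= hi k < n) -> diam lo hi <= d * n.-1.
Proof.
move=> h; rewrite -[d in d * _]card_ord -sum_nat_const; apply: leq_sum => k _.
by move: (h k); lia.
Qed.

Lemma timely_box_grow lo hi b v :
  timely_box lo hi -> b \in box lo hi -> adjacent v b -> v \notin box lo hi ->
  v \in infected A 'C((diam lo hi).+1, 2).+1 ->
  let lo' := fun k => minn (lo k) (v k) in
  let hi' := fun k => maxn (hi k) (v k) in
  diam lo' hi' = (diam lo hi).+1 /\ timely_box lo' hi'.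
Proof.
move=> [lohi Bt] bB vb vB vt lo' hi'.
have vbc := boxP _ _ _ bB.
have [i [vbi vbj]] := adjacent_coordP vb.
have vi : ~~ (lo i <= v i <= hi i).
  have [i0 vi0] := notin_boxP vB; suff <- : i0 = i by [].
  by apply/eqP; apply: contraT => /vbj e; move: (vbc i0) vi0; rewrite e; lia.
have dS : diam lo' hi' = (diam lo hi).+1.
  have := @sum_change1 _ (fun k => hi' k - lo' k) (fun k => hi k - lo k) i.
  rewrite -!/(diam _ _) => e.
  have {}e : diam lo' hi' + (hi i - lo i) = diam lo hi + (hi' i - lo' i).
    by apply: e => k /vbj e; rewrite /lo' /hi' e; move: (vbc k); lia.
  by move: e; rewrite {2}/lo' {2}/hi'; move: (vbc i) vi vbi; lia.
split=> //; split.
  by move=> k; move: (lohi k) (ltn_ord (v k)); rewrite /lo' /hi'; lia.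
have := @box_grow A 'C((diam lo hi).+1, 2).+1 lo hi b v _ vt bB vb.
rewrite dS => h; apply: subset_trans (h _) (infected_mono _ _).
  exact: subset_trans Bt (infected_mono _ (leqnSn _)).
by rewrite [leqRHS]binS bin1; lia.
Qed.

Lemma percolates_timely : 0 < n -> percolates A ->
  infected A 'C((d * n.-1).+1, 2) = [set: grid n d].
Proof.
move=> n0 [t /eqP At].
pose U := [set w | `[< exists lo hi, timely_box lo hi /\ w \in box lo hi >]].
have UP w : w \in U -> exists lo hi, timely_box lo hi /\ w \in box lo hi.
  by rewrite inE => /asboolP.
have PU w lo hi : timely_box lo hi -> w \in box lo hi -> w \in U.
  by move=> h1 h2; rewrite inE; apply/asboolP; exists lo, hi.
have AU : A \subset U.
  apply/subsetP => a aA; apply: (PU a (fun k => a k : nat) (fun k => a k : nat)).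
    split=> [k|]; first by rewrite leqnn ltn_ord.
    apply/subsetP => w /boxP wa.
    have -> : w = a by apply/ffunP => k; apply: ord_inj; move: (wa k); lia.
    exact: (subsetP (infected_mono A (leq0n _))).
  by apply/boxP => k; rewrite !leqnn.
have cU : infection_step U \subset U.
  apply/subsetP => w /infection_stepP [//|[u1 [u2 []]]].
  move=> /UP [lo1 [hi1 [g1 b1]]] /UP [lo2 [hi2 [g2 b2]]].
  wlog le21 : u1 u2 lo1 hi1 g1 b1 lo2 hi2 g2 b2 /
      diam lo2 hi2 <= diam lo1 hi1.
    move=> h a1 a2 u12; have [le|/ltnW le] := leqP (diam lo2 hi2) (diam lo1 hi1).
      exact: (h u1 u2 lo1 hi1 g1 b1 lo2 hi2).
    by apply: (h u2 u1 lo2 hi2 g2 b2 lo1 hi1 g1 b1) => //; rewrite eq_sym.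
  move=> a1 a2 u12.
  have [wB|wB] := boolP (w \in box lo1 hi1); first exact: (PU _ _ _ g1).
  have wt : w \in infected A 'C((diam lo1 hi1).+1, 2).+1.
    rewrite infectedS; apply/infection_stepP; right; exists u1, u2; split=> //.
      exact: subsetP g1.2 _ b1.
    apply: (subsetP (infected_mono A _)) (subsetP g2.2 _ b2).
    by rewrite leq_bin2l // ltnS.
  have [_ g] := timely_box_grow g1 b1 a1 wB wt.
  by apply: (PU _ _ _ g); apply/boxP => k; rewrite geq_minr leq_maxr.
have UT w : w \in U.
  have : w \in infected A t by rewrite At inE.
  exact: subsetP (infected_sub_closed t AU cU) w.
pose P s := `[< exists lo hi, timely_box lo hi /\ diam lo hi = s >].
have exP : exists s, P s.
  have /UP [lo [hi [g _]]] := UT [ffun=> Ordinal n0].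
  by exists (diam lo hi); apply/asboolP; exists lo, hi.
have leP s : P s -> s <= d * n.-1.
  by move=> /asboolP [lo [hi [g <-]]]; exact: diam_le g.1.
case: (ex_maxnP exP leP) => s /asboolP [lo [hi [g ds]]] smax.
have [lohi Bt] := g.
have BT w : w \in box lo hi.
  apply: contraT => /notin_boxP [i wi]; exfalso.
  have cn k : lo k < n by move: (lohi k); lia.
  pose c : grid n d := [ffun k => Ordinal (cn k)].
  have bnd : hi i < n by move: (lohi i); lia.
  pose b := set_coord c i (if w i < lo i then Ordinal (cn i) else Ordinal bnd).
  have bB : b \in box lo hi.
    apply/boxP => k; have [->|ki] := eqVneq k i.
      by rewrite set_coord_same; move: (lohi i); case: ifP => /=; lia.
    by rewrite set_coord_other // ffunE /=; move: (lohi k); lia.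
  have : b i != w i.
    apply/negP => /eqP e; move: (boxP _ _ _ bB i) wi.
    by rewrite e => ->.
  move=> /ord_step_toward [x [bx xw]].
  pose v := set_coord b i x.
  have bv : adjacent b v by exact: adjacent_set_coord.
  have vb : adjacent v b by rewrite /adjacent l1_distC.
  have vB : v \notin box lo hi.
    apply/negP => /boxP /(_ i); move: bx xw wi (lohi i).
    by rewrite !set_coord_same; case: ifP => /=; lia.
  have /UP [lo2 [hi2 [g2 b2]]] := UT v.
  have le2 : diam lo2 hi2 <= diam lo hi.
    by rewrite ds; apply: smax; apply/asboolP; exists lo2, hi2.
  have vt : v \in infected A 'C((diam lo hi).+1, 2).+1.
    apply: (subsetP (infected_mono A _)) (subsetP g2.2 _ b2).
    by rewrite ltnW // ltnS leq_bin2l // ltnS.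
  have [dS g'] := timely_box_grow g bB vb vB vt.
  suff : diam lo hi < s by rewrite ds ltnn.
  by rewrite -dS; apply: smax; apply/asboolP; do 2 eexists; split; first exact: g'.
apply/setP => w; rewrite inE; apply: (subsetP (infected_mono A _)) (subsetP Bt _ (BT w)).
by rewrite leq_bin2l // ltnS diam_le.
Qed.

End UpperBound.
End GridGeometry.

Lemma max_percolation_time_le d n : 0 < n ->
  max_percolation_time d n <= 'C((d * n.-1).+1, 2).
Proof.
move=> n0; apply/bigmax_leqP => A _; rewrite /percolation_time.
case: pselect => // A_perc; case: ex_minnP => m _; apply.
by apply/eqP/percolates_timely.
Qed.

Section SlowGrowth.
Variables n d : nat.
Implicit Types (u v w b : grid n.+1 d) (i j k : 'I_d) (s : bool).
Implicit Types (A : {set grid n.+1 d}) (l r : seq ('I_d * nat)).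

(* A list of steps (i, g) is executed from its head: a step lengthens the
   current box by g in direction i.  The box [stage l] is the one from which the
   steps of l lead to the whole grid, so boxes are computed backwards, from the
   end of the list.  [side l k] tells at which end (true: the upper one) of
   coordinate k the site of the first step of l lies; from one step to the next
   all ends are exchanged, except the one in the direction of growth. *)
Fixpoint side l k : bool :=
  if l is (i, _) :: r then (if k == i then side r k else ~~ side r k) else true.

Fixpoint offset l (s : bool) k : nat :=
  if l is (i, g) :: r then
    offset r s k + (if (k == i) && (side r k == s) then g else 0)
  else 0.

Definition used l k := offset l false k + offset l true k.

Definition lower l k := offset l false k.
Definition upper l k := n - offset l true k.

Definition stage l : {set grid n.+1 d} := box n.+1 (lower l) (upper l).

Definition corner l (c : 'I_d -> bool) k := if c k then upper l k else lower l k.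

Fixpoint sites l : {set grid n.+1 d} :=
  if l is _ :: r then
    [set w : grid n.+1 d | [forall k, w k == corner r (side l) k :> nat]]
      :|: sites r
  else set0.

(* Two consecutive steps of length 1 would put the site of the second one at
   distance 2 from the box of the first one. *)
Fixpoint admissible l : bool :=
  if l is (_, g) :: r then
    [&& 0 < g <= 2, (if r is (_, h) :: _ then 3 <= g + h else true)
      & admissible r]
  else true.

Definition roomy l := forall k, used l k + 3 <= n.

(* The number of steps that an infection needs to sweep the new layers of a
   step in direction i. *)
Definition reach i r := \sum_(k < d | k != i) (n - used r k).

Fixpoint duration l : nat :=
  if l is (i, _) :: r then (reach i r - 2) + duration r else 0.

Lemma side_same i g r : side ((i, g) :: r) i = side r i.
Proof. by rewrite /= eqxx. Qed.

Lemma side_other i g r k : k != i -> side ((i, g) :: r) k = ~~ side r k.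
Proof. by move=> /negbTE ki; rewrite /= ki. Qed.

Lemma offset_same i g r s :
  offset ((i, g) :: r) s i = offset r s i + (if side r i == s then g else 0).
Proof. by rewrite /= eqxx. Qed.

Lemma offset_other i g r s k : k != i ->
  offset ((i, g) :: r) s k = offset r s k.
Proof. by move=> /negbTE ki; rewrite /= ki addn0. Qed.

Lemma leq_offset x r s k : offset r s k <= offset (x :: r) s k.
Proof. by case: x => i g; exact: leq_addr. Qed.

Lemma used_cons i g r k :
  used ((i, g) :: r) k = used r k + (if k == i then g else 0).
Proof. by rewrite /used /=; case: eqP => _ /=; case: (side r k) => /=; lia. Qed.

Lemma roomy_tail x r : roomy (x :: r) -> roomy r.
Proof.
move=> h k; move: (h k) (leq_offset x r true k) (leq_offset x r false k).
by rewrite /used; lia.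
Qed.

Lemma admissible_tail x r : admissible (x :: r) -> admissible r.
Proof. by case: x => i g /and3P []. Qed.

Lemma sites_headP x r w :
  reflect (forall k, w k = corner r (side (x :: r)) k :> nat)
    (w \in [set w : grid n.+1 d | [forall k, w k == corner r (side (x :: r)) k :> nat]]).
Proof.
by rewrite inE; apply: (iffP forallP) => h k; apply/eqP; exact: h.
Qed.

Lemma in_sites x r w : w \in sites (x :: r) ->
  (forall k, w k = corner r (side (x :: r)) k :> nat) \/ w \in sites r.
Proof. by rewrite [sites _]/= in_setU => /orP [/sites_headP|]; [left|right]. Qed.

Lemma stage_sub x r : stage (x :: r) \subset stage r.
Proof.
apply/subsetP => w /boxP h; apply/boxP => k; move: (h k).
move: (leq_offset x r true k) (leq_offset x r false k).
by rewrite /lower /upper; lia.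
Qed.

Lemma head_site_stage x r w : roomy r ->
  (forall k, w k = corner r (side (x :: r)) k :> nat) -> w \in stage r.
Proof.
move=> h wE; apply/boxP => k; rewrite wE /corner.
by move: (h k); rewrite /used /lower /upper; case: ifP => _; lia.
Qed.

Lemma next_site_far x y r u w :
  admissible [:: x, y & r] -> roomy [:: x, y & r] ->
  u \in stage [:: x, y & r] ->
  (forall k, w k = corner r (side (y :: r)) k :> nat) ->
  3 <= l1_dist u w.
Proof.
case: x y => [i g] [j h] /and3P [g02 gh3 /and3P [h02 _ _]] rm /boxP uB wE.
have [ij|ij] := eqVneq i j.
  subst j; apply: leq_trans (l1_dist_ge_coord i u w).
  move: (uB i) (wE i) (rm i); rewrite /corner /used /lower /upper.
  rewrite !offset_same !side_same; case: (side r i) => /=; lia.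
apply: leq_trans (l1_dist_ge_coord2 u w ij).
have ji : j != i by rewrite eq_sym.
move: (uB i) (uB j) (wE i) (wE j) (rm i) (rm j).
rewrite /corner /used /lower /upper !offset_same !(offset_other _ _ _ ji).
rewrite !offset_same !(offset_other _ _ _ ij) !side_same !(side_other _ _ ij).
case: (side r i); case: (side r j) => /=; lia.
Qed.

Lemma sites_far x r u w :
  admissible (x :: r) -> roomy (x :: r) ->
  u \in stage (x :: r) -> w \in sites r -> 3 <= l1_dist u w.
Proof.
elim: r x => [|y r IH] x ok rm uB; first by rewrite inE.
move=> /in_sites [wE|wr]; first exact: (next_site_far ok rm uB wE).
apply: IH (admissible_tail ok) (roomy_tail rm) _ wr.
exact: (subsetP (stage_sub x (y :: r))).
Qed.

Lemma next_site_coord i g y r w k :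
  roomy (y :: r) -> k != i ->
  (forall k, w k = corner r (side (y :: r)) k :> nat) ->
  n - used (y :: r) k
    <= `|w k - corner (y :: r) (side [:: (i, g), y & r]) k|%N.
Proof.
move=> /(_ k) rm ki /(_ k) ->; move: rm; rewrite /corner /used side_other //.
move: (leq_offset y r true k) (leq_offset y r false k).
by rewrite /lower /upper; case: (side (y :: r) k) => /=; lia.
Qed.

Lemma other_coord i : 1 < d -> exists k, k != i.
Proof.
move=> d1; have : 0 < #|predC1 i| by rewrite cardC1 card_ord; lia.
by case/card_gt0P => k ki; exists k; move: ki; rewrite inE.
Qed.

Hypothesis d_gt1 : 1 < d.

Lemma sites_separated r w1 w2 : admissible r -> roomy r ->
  w1 \in sites r -> w2 \in sites r -> w1 != w2 -> 3 <= l1_dist w1 w2.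
Proof.
elim: r w1 w2 => [|x r IH] w1 w2 ok rm; first by rewrite inE.
have head v w : (forall k, v k = corner r (side (x :: r)) k :> nat) ->
    w \in sites r -> 3 <= l1_dist v w.
  move=> vE; case: r IH ok rm vE => [|y r] IH ok rm vE; first by rewrite inE.
  have vB := head_site_stage (roomy_tail rm) vE.
  move=> /in_sites [wE|]; last first.
    exact: (sites_far (admissible_tail ok) (roomy_tail rm) vB).
  case: x ok rm vE {vB IH} => i g ok rm vE.
  have [k ki] := other_coord i d_gt1.
  apply: leq_trans (l1_dist_ge_coord k v w).
  have := next_site_coord g (roomy_tail rm) ki wE; rewrite -vE.
  by move: (roomy_tail rm k); lia.
move=> /in_sites [w1E|w1r] /in_sites [w2E|w2r] w12.
- by case/eqP: w12; apply/ffunP => k; apply: ord_inj; rewrite w1E w2E.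
- exact: head.
- by rewrite l1_distC; exact: head.
- exact: IH (admissible_tail ok) (roomy_tail rm) w1r w2r w12.
Qed.

Definition front i g r t : {set grid n.+1 d} :=
  [set w in stage r |
    \sum_(k < d | k != i) `|w k - corner r (side ((i, g) :: r)) k|%N <= t].

Definition frontier i g r t : {set grid n.+1 d} :=
  stage ((i, g) :: r) :|: front i g r t :|: sites r.

Lemma adjacent_close w u1 u2 : adjacent w u1 -> adjacent w u2 ->
  l1_dist u1 u2 <= 2.
Proof.
move=> /eqP a1 /eqP a2; apply: leq_trans (l1_dist_triangle w _ _) _.
by rewrite l1_distC a1 a2.
Qed.

Lemma partial_dist (P : pred 'I_d) (c : 'I_d -> nat) u w :
  \sum_(k < d | P k) `|u k - c k|%N <=
    \sum_(k < d | P k) `|w k - c k|%N + l1_dist u w.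
Proof.
apply: (@leq_trans (\sum_(k < d | P k) (`|w k - c k|%N + `|u k - w k|%N))).
  by apply: leq_sum => k _; lia.
by rewrite big_split leq_add2l [leqRHS](bigID P) leq_addr.
Qed.

Lemma front_site_far i g r t u v :
  admissible ((i, g) :: r) -> roomy ((i, g) :: r) -> t + 2 < reach i r ->
  u \in front i g r t -> v \in sites r -> 3 <= l1_dist u v.
Proof.
case: r => [|y r] ok rm tlt; first by rewrite [v \in _]inE.
rewrite inE => /andP [uB ut] /in_sites [vE|vr]; last first.
  exact: (sites_far (admissible_tail ok) (roomy_tail rm) uB vr).
have : reach i (y :: r) <=
    \sum_(k < d | k != i) `|v k - corner (y :: r) (side [:: (i, g), y & r]) k|%N.
  by apply: leq_sum => k ki; exact: next_site_coord (roomy_tail rm) ki vE.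
have := partial_dist (fun k => k != i) (corner (y :: r) (side [:: (i, g), y & r])) v u.
by rewrite (l1_distC v u); move: ut tlt; lia.
Qed.

Lemma frontier_step i g r t :
  admissible ((i, g) :: r) -> roomy ((i, g) :: r) -> t + 2 < reach i r ->
  infection_step (frontier i g r t) \subset frontier i g r t.+1.
Proof.
move=> ok rm tlt; set l := (i, g) :: r.
have okr := admissible_tail ok; have rmr := roomy_tail rm.
pose c := corner r (side l).
apply/subsetP => w /infection_stepP [|[u1 [u2 [h1 h2 a1 a2 u12]]]].
  rewrite !inE => /orP [/orP [->//|/andP [wB wt]]|->]; last by rewrite orbT.
  by rewrite wB (leq_trans wt) ?orbT.
have close := adjacent_close a1 a2.
have stage_site u v : adjacent w u -> adjacent w v ->
    u \in stage l -> v \in sites r -> False.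
  move=> au av uB vr; have := sites_far ok rm uB vr.
  by rewrite leqNgt ltnS (adjacent_close au av).
have site_site : u1 \in sites r -> u2 \in sites r -> False.
  move=> s1 s2; have := sites_separated okr rmr s1 s2 u12.
  by rewrite leqNgt ltnS close.
have front_stage u : u \in front i g r t -> u \in stage r.
  by rewrite inE => /andP [].
have stage_next u : u \in stage l -> u \in stage r by exact: (subsetP (stage_sub _ _)).
have [wB|wB] := boolP (w \in stage r).
  have front_w u : u \in front i g r t -> adjacent w u -> w \in frontier i g r t.+1.
    rewrite inE => /andP [_ ut] /eqP wu.
    rewrite !in_setU [w \in front _ _ _ _]inE wB.
    have := partial_dist (fun k => k != i) c w u; rewrite wu => h.
    by rewrite (leq_trans h) ?orbT // addn1 ltnS.
  rewrite !in_setU in h1 h2; move: h1 h2 => /orP [/orP [s1|f1]|v1]; last first.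
  - move=> /orP [/orP [s2|f2]|v2]; last by case: site_site.
      by case: (stage_site u2 u1).
    exact: front_w f2 a2.
  - by move=> _; exact: front_w f1 a1.
  move=> /orP [/orP [s2|f2]|v2]; last by case: (stage_site u1 u2).
    have [wl|wl] := boolP (w \in stage l); first by rewrite !in_setU wl.
    by case/eqP: u12; exact: box_neighbor_unique wl s1 s2 a1 a2.
  exact: front_w f2 a2.
exfalso.
have front_site u v : adjacent w u -> adjacent w v ->
    u \in front i g r t -> v \in sites r -> False.
  move=> au av uF vr; have := front_site_far ok rm tlt uF vr.
  by rewrite leqNgt ltnS (adjacent_close au av).
have box_box : u1 \in stage r -> u2 \in stage r -> False.
  by move=> s1 s2; case/eqP: u12; exact: box_neighbor_unique wB s1 s2 a1 a2.
move: h1 h2; rewrite !in_setU => /orP [/orP [s1|f1]|v1] /orP [/orP [s2|f2]|v2].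
- exact: box_box (stage_next _ s1) (stage_next _ s2).
- exact: box_box (stage_next _ s1) (front_stage _ f2).
- exact: (stage_site u1 u2).
- exact: box_box (front_stage _ f1) (stage_next _ s2).
- exact: box_box (front_stage _ f1) (front_stage _ f2).
- exact: (front_site u1 u2).
- exact: (stage_site u2 u1).
- exact: (front_site u2 u1).
- exact: site_site.
Qed.

Lemma infected_frontier A i g r t :
  admissible ((i, g) :: r) -> roomy ((i, g) :: r) -> t <= reach i r - 2 ->
  A \subset stage ((i, g) :: r) :|: sites ((i, g) :: r) ->
  infected A t \subset frontier i g r t.
Proof.
move=> ok rm; elim: t => [|t IH] tle AB.
  apply: (subset_trans AB); apply/subsetP => w; rewrite in_setU => /orP [wB|].
    by rewrite !in_setU wB.
  move=> /in_sites [wE|wr]; rewrite !in_setU; last by rewrite wr orbT.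
  rewrite [w \in front _ _ _ _]inE (head_site_stage (roomy_tail rm) wE) /=.
  by rewrite big1 ?orbT // => k _; rewrite wE distnn.
rewrite infectedS; apply: subset_trans (infection_stepS (IH _ AB)) _; first by lia.
by apply: frontier_step => //; lia.
Qed.

Lemma reach_ge3 i r : roomy r -> 3 <= reach i r.
Proof.
move=> rm; have [k ki] := other_coord i d_gt1.
by rewrite /reach (bigD1 k) //=; move: (rm k); lia.
Qed.

Lemma not_full_at_duration l A : l != [::] -> admissible l -> roomy l ->
  A \subset stage l :|: sites l -> infected A (duration l) != [set: grid n.+1 d].
Proof.
elim: l A => [//|[i g] r IH] A _ ok rm AB.
have rmr := roomy_tail rm.
have At := infected_frontier ok rm (leqnn _) AB.
rewrite /duration -/duration infectedD.
case: r IH ok rm rmr AB At => [|y r] IH ok rm rmr AB At; last first.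
  apply: IH => //; first exact: admissible_tail ok.
  apply: subset_trans At _; apply/subsetP => w.
  rewrite !in_setU -orbA => /or3P [wB|wF|->]; last by rewrite orbT.
    by rewrite (subsetP (stage_sub (i, g) (y :: r))).
  by move: wF; rewrite [w \in front _ _ _ _]inE => /andP [->].
pose w : grid n.+1 d := [ffun=> ord_max].
suff wN : w \notin frontier i g [::] (reach i [::] - 2).
  apply/eqP => /= e; case/negP: wN; apply: (subsetP At).
  by move: (in_setT w); rewrite -e.
rewrite !in_setU [w \in sites _]inE orbF negb_or; apply/andP; split.
  apply/negP => /boxP /(_ i).
  move: (rm i); rewrite /used /lower /upper offset_same ffunE /= !eqxx /=.
  by case/and3P: ok; lia.
rewrite [w \in front _ _ _ _]inE negb_and -ltnNge; apply/orP; right.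
apply: (@leq_trans (reach i [::])); first by have := reach_ge3 i rmr; lia.
apply: leq_sum => k ki; rewrite /corner side_other // ffunE /lower /=; lia.
Qed.

Lemma grow_to_site A t lo hi b v i :
  box n.+1 lo hi \subset infected A t -> v \in infected A t ->
  b \in box n.+1 lo hi -> (forall k, k != i -> v k = b k) ->
  0 < `|v i - b i|%N <= 2 ->
  exists t', box n.+1 (fun k => minn (lo k) (v k)) (fun k => maxn (hi k) (v k))
    \subset infected A t'.
Proof.
move=> Bt vt bB vb dvb.
have vE : v = set_coord b i (v i).
  by apply/ffunP => k; have [->|ki] := eqVneq k i;
    rewrite ?set_coord_same ?set_coord_other // vb.
have vbi : v i != b i by apply/negP => /eqP e; move: dvb; rewrite e distnn.
have [x [vx xb]] := ord_step_toward vbi.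
have [e1|e2] : `|v i - b i|%N = 1 \/ `|v i - b i|%N = 2 by lia.
  exists (t + diam lo hi); apply: box_grow bB _ => //.
  by rewrite vE /adjacent l1_distC; apply: adjacent_set_coord; lia.
pose m := set_coord v i x.
have vm : adjacent v m by exact: adjacent_set_coord.
have mb : adjacent m b.
  rewrite /adjacent.
  have -> : b = set_coord m i (b i).
    by apply/ffunP => k; have [->|ki] := eqVneq k i;
      rewrite ?set_coord_same ?set_coord_other // vb.
  by apply: adjacent_set_coord; rewrite set_coord_same; lia.
have mt : m \in infected A t.+1.
  rewrite infectedS; apply/infection_stepP; right; exists v, b; split=> //.
  - exact: (subsetP Bt).
  - by rewrite /adjacent l1_distC.
  - by apply: contraNneq vbi => ->.
have Bt1 : box n.+1 lo hi \subset infected A t.+1.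
  exact: subset_trans Bt (infected_mono A (leqnSn t)).
have G1 := box_grow Bt1 mt bB mb.
have vt1 : v \in infected A (t.+1 + diam lo hi).
  by apply: (subsetP (infected_mono A _)) vt; rewrite addSnnS leq_addr.
have mB : m \in box n.+1 (fun k => minn (lo k) (m k)) (fun k => maxn (hi k) (m k)).
  by apply/boxP => k; rewrite geq_minr leq_maxr.
have G2 := box_grow G1 vt1 mB vm.
eexists; apply: subset_trans G2; apply/subsetP => w /boxP wB; apply/boxP => k.
by move: (wB k); clear; lia.
Qed.

Lemma stage_full_next A t i g r w :
  admissible ((i, g) :: r) -> roomy ((i, g) :: r) ->
  stage ((i, g) :: r) \subset infected A t ->
  (forall k, w k = corner r (side ((i, g) :: r)) k :> nat) ->
  w \in infected A t -> exists t', stage r \subset infected A t'.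
Proof.
move=> /and3P [g02 _ _] rm Bt wE wt; set l := (i, g) :: r.
have rml : roomy l := rm.
have cn k : corner l (side l) k < n.+1.
  by move: (rml k); rewrite /corner /lower /upper /used; case: ifP => _; lia.
pose b : grid n.+1 d := [ffun k => Ordinal (cn k)].
have bE k : b k = corner l (side l) k :> nat by rewrite ffunE.
have bB : b \in stage l.
  by apply/boxP => k; rewrite bE; move: (rml k);
    rewrite /corner /lower /upper /used; case: ifP => _; lia.
have wb k : k != i -> w k = b k.
  move=> ki; apply: ord_inj; rewrite wE bE /corner /lower /upper.
  by rewrite !offset_other.
have wbi : 0 < `|w i - b i|%N <= 2.
  move: (rm i); rewrite wE bE /corner /lower /upper /used /l !offset_same side_same.
  by case: (side r i) => /=; lia.
have [t' G] := grow_to_site Bt wt bB wb wbi.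
exists t'; apply: subset_trans G; apply/subsetP => u /boxP uB; apply/boxP => k.
move: (uB k) (rm k) (wE k).
have [->|ki] := eqVneq k i.
  rewrite /corner /lower /upper /used !offset_same side_same.
  by case: (side r i) => /=; lia.
by rewrite /lower /upper !offset_other //; lia.
Qed.

Lemma stage_sites_full l A t : admissible l -> roomy l ->
  stage l \subset infected A t -> sites l \subset infected A t ->
  exists t', infected A t' = [set: grid n.+1 d].
Proof.
elim: l t => [|[i g] r IH] t ok rm Bt St.
  exists t; apply/setP => w; rewrite inE; apply: (subsetP Bt).
  by apply/boxP => k; rewrite /lower /upper /= subn0 -ltnS ltn_ord.
have cn k : corner r (side ((i, g) :: r)) k < n.+1.
  by move: (roomy_tail rm k); rewrite /corner /lower /upper /used; case: ifP => _; lia.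
pose w : grid n.+1 d := [ffun k => Ordinal (cn k)].
have wE k : w k = corner r (side ((i, g) :: r)) k :> nat by rewrite ffunE.
have wt : w \in infected A t.
  by apply: (subsetP St); rewrite in_setU; apply/orP; left; apply/sites_headP.
have [t' Bt'] := stage_full_next ok rm Bt wE wt.
apply: (IH (t + t')); first exact: admissible_tail ok.
- exact: roomy_tail rm.
- exact: subset_trans Bt' (infected_mono A (leq_addl _ _)).
apply: subset_trans (subset_trans St (infected_mono A (leq_addr _ _))).
exact: subsetUr.
Qed.

Lemma duration_le_max_percolation_time l : admissible l -> roomy l ->
  duration l <= max_percolation_time d n.+1.
Proof.
have [->//|l0] := eqVneq l [::]; move=> ok rm.
pose A := stage l :|: sites l.
have A_perc : percolates A.
  have [||t At] := @stage_sites_full l A 0 ok rm; rewrite ?subsetUl ?subsetUr //.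
  by exists t; rewrite At.
apply: leq_trans (leq_bigmax_cond _ _); last exact/asboolP/A_perc.
rewrite /percolation_time; case: pselect => // A_perc'.
case: ex_minnP => m /eqP Am _; rewrite leqNgt; apply/negP => /ltnW lt.
have /negP := not_full_at_duration l0 ok rm (subxx A); apply.
by rewrite eqEsubset subsetT -Am infected_mono.
Qed.

End SlowGrowth.

Section Schedule.
Variables n D p : nat.
Hypothesis n_ge : 9 * p + 3 <= n.
Hypothesis D_gt0 : 0 < D.
Let q := 3 * p.
Local Notation steps := (seq ('I_D.+1 * nat)).
Implicit Types (r : steps) (i j k : 'I_D.+1).

Definition block i j : steps := [:: (i, 2); (j, 1)].

Definition repeat_block i j a r : steps := iter a (cat (block i j)) r.

(* With d = D + 1 coordinates of size about 9p, the first stage is a segment of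
   length about 3p in direction 0.  For j = 0, ..., D - 1, the 3p blocks at the
   head of [schedule (D - j)] fill up direction j and bring direction j + 1 to
   length about 3p; [schedule 0] then fills up direction D. *)
Fixpoint schedule m : steps :=
  if m is m'.+1 then
    repeat_block (inord (D - m)) (inord (D - m')) q (schedule m')
  else repeat_block ord_max ord_max (2 * p) [::].

Lemma scheduleS m : schedule m.+1 =
  repeat_block (inord (D - m.+1)) (inord (D - m)) q (schedule m).
Proof. by []. Qed.

Lemma used_repeat_block i j a r k :
  used (repeat_block i j a r) k =
    used r k + (if k == i then 2 * a else 0) + (if k == j then a else 0).
Proof.
elim: a => [|a IH]; first by do 2 case: eqP => _; rewrite ?muln0 ?addn0.
rewrite /repeat_block iterS -/(repeat_block _ _ _ _) /block /= !used_cons IH.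
by do 2 case: (k == _); lia.
Qed.

Definition alternating r :=
  admissible r && (if r is (_, h) :: _ then h == 2 else true).

Lemma alternating_repeat_block i j a r :
  alternating r -> alternating (repeat_block i j a r).
Proof.
move=> alt_r; elim: a => [//|a]; rewrite /repeat_block iterS.
move: (iter _ _ _) => {alt_r} [|[i' h] r'] //=.
by rewrite /alternating /= => /andP [/and3P [-> -> ->] /eqP ->].
Qed.

Lemma alternating_schedule m : alternating (schedule m).
Proof. by elim: m => [|m IH]; apply: alternating_repeat_block. Qed.

Lemma used_schedule m k : m <= D ->
  used (schedule m) k =
    if k < D - m then 0 else if k == D - m :> nat then 6 * p else 9 * p.
Proof.
elim: m k => [|m IH] k mD; rewrite ?scheduleS used_repeat_block.
  rewrite /used /= subn0 -(inj_eq val_inj) /=.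
  by move: (ltn_ord k); case: (ltnP k D); case: eqP; lia.
rewrite IH; last by lia.
rewrite -!(inj_eq val_inj) /= !inordK; [|by lia..].
rewrite /q; case: (ltnP k (D - m)); case: eqP; case: eqP;
  case: (ltnP k (D - m.+1)); lia.
Qed.

Lemma roomy_schedule m : m <= D -> roomy n (schedule m).
Proof.
move=> mD k; rewrite used_schedule //; case: ltnP; first by lia.
by case: eqP; lia.
Qed.

Lemma reach_ge (j : nat) i k r : j <= i -> j <= k -> k != i ->
  (forall k', k' < j -> used r k' = 0) -> j * n + (n - used r k) <= reach n i r.
Proof.
move=> ji jk ki r0; rewrite /reach (bigD1 k) //= addnC leq_add2l.
have jD : j <= D.+1 by have := ltn_ord i; lia.
have -> : j * n = \sum_(k' < D.+1 | k' < j) n.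
  by rewrite -(big_ord_widen _ (fun=> n) jD) sum_nat_const card_ord.
rewrite big_mkcond [leqRHS]big_mkcond; apply: leq_sum => k' _.
case: ltnP => // k'j; rewrite r0 // subn0.
suff [-> ->] : k' != i /\ k' != k by [].
by split; apply/eqP => e; move: k'j; rewrite e; lia.
Qed.

Lemma duration_cons i g r :
  duration n ((i, g) :: r) = reach n i r - 2 + duration n r.
Proof. by []. Qed.

Lemma duration_last_phase :
  8 * D * q ^ 2 <= 2 * duration n (schedule 0) + 16 * p.
Proof.
rewrite [schedule 0]/=.
suff h a : 2 * a * (D * n) <= duration n (repeat_block ord_max ord_max a [::]) + 4 * a.
  have := h (2 * p); have : D * (9 * p) <= D * n by rewrite leq_mul2l; lia.
  rewrite /q; nia.
elim: a => [//|a IH].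
rewrite /repeat_block iterS -/(repeat_block _ _ _ _).
set r := repeat_block _ _ _ _ in IH *.
rewrite [block _ _ ++ _]/= !duration_cons.
have x_lt : D.-1 < D.+1 by lia.
pose x : 'I_D.+1 := Ordinal x_lt.
have xmax : x != ord_max by rewrite -(inj_eq val_inj) /=; lia.
have r0 k : k < D -> used r k = 0.
  move=> kD; rewrite used_repeat_block -(inj_eq val_inj) /=.
  by case: eqP => [|_]; [lia|].
have h1 : D * n <= reach n ord_max r.
  apply: leq_trans (@reach_ge D.-1 ord_max x r _ _ _ _) => //=.
  - by rewrite r0 //=; [nia|lia].
  - by move=> k' k'D; apply: r0; lia.
have h2 : D * n <= reach n ord_max ((ord_max, 1) :: r).
  apply: leq_trans h1 _; apply: leq_sum => k kmax.
  by rewrite used_cons (negbTE kmax) addn0.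
by move: IH h1 h2; nia.
Qed.

Lemma duration_phase m : m < D ->
  2 * duration n (schedule m) + (12 * (D - m.+1) + 5) * q ^ 2
    <= 2 * duration n (schedule m.+1) + 10 * q.
Proof.
move=> mD; rewrite scheduleS; set r := schedule m.
set j := D - m.+1.
have -> : D - m = j.+1 by lia.
have jv : (inord j : 'I_D.+1) = j :> nat by rewrite inordK //; lia.
have j1v : (inord j.+1 : 'I_D.+1) = j.+1 :> nat by rewrite inordK //; lia.
set i1 := inord j; set i2 := inord j.+1.
have i12 : i1 != i2 by rewrite -(inj_eq val_inj) /= jv j1v; lia.
have usedE a k : used (repeat_block i1 i2 a r) k =
    if k < j then 0 else if k == i1 then 2 * a else
    if k == i2 then 6 * p + a else 9 * p.
  rewrite used_repeat_block used_schedule; last by lia.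
  rewrite -!(inj_eq val_inj) /= jv j1v.
  have -> : D - m = j.+1 by lia.
  case: (ltnP k j); case: (ltnP k j.+1); case: eqP; case: eqP; lia.
suff h a : a <= q -> 2 * duration n r + 2 * a * (6 * q * j + 4 * q) <=
    2 * duration n (repeat_block i1 i2 a r) + 3 * a ^ 2 + 10 * a.
  by have := h q (leqnn q); nia.
elim: a => [|a IH] aq; first by rewrite !(muln0, mul0n, addn0).
have {}IH := IH (ltnW aq); have := usedE a; move: IH.
rewrite /repeat_block iterS -/(repeat_block _ _ _ _).
set r' := repeat_block _ _ _ _ => IH uE.
rewrite [block _ _ ++ _]/= !duration_cons.
have h2 : j * n + (n - 2 * a) <= reach n i2 r'.
  have := @reach_ge j i2 i1 r'; rewrite uE jv j1v ltnn eqxx; apply=> //.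
  by move=> k kj; rewrite uE kj.
have h1 : j * n + (n - (6 * p + a.+1)) <= reach n i1 ((i2, 1) :: r').
  have := @reach_ge j i1 i2 ((i2, 1) :: r').
  rewrite used_cons uE jv j1v [i2 == i1]eq_sym (negbTE i12) eqxx ltnNge leqnSn /=.
  rewrite -addnA addn1; apply=> //.
  move=> k kj; rewrite used_cons uE kj add0n; case: eqP => // e.
  by move: kj; rewrite e j1v; lia.
have h3 : j * (9 * p) <= j * n by rewrite leq_mul2l; lia.
by move: IH h1 h2 h3 aq n_ge; rewrite /q; clear; lia.
Qed.

Lemma duration_schedule :
  D * (6 * D + 7) * q ^ 2 <= 2 * duration n (schedule D) + 16 * p + 10 * q * D.
Proof.
suff h m : m <= D -> (D * (6 * D + 7) + (D - m)) * q ^ 2 <=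
    2 * duration n (schedule m) + 16 * p + 10 * q * m + 6 * (D - m) ^ 2 * q ^ 2.
  by have := h D (leqnn D); rewrite subnn; nia.
elim: m => [|m IH] mD.
  by have := duration_last_phase; rewrite subn0; nia.
have := IH (ltnW mD); have := duration_phase mD.
have -> : D - m = (D - m.+1).+1 by lia.
move: (D - m.+1) (q ^ 2) => x Q.
have -> : x.+1 ^ 2 = x ^ 2 + 2 * x + 1 by rewrite -addn1 sqrnD; lia.
move: (x ^ 2) (D * (6 * D + 7)) => y z h1 h2; lia.
Qed.

End Schedule.

Lemma max_percolation_time_ge D p n : 9 * p + 3 <= n ->
  D * (6 * D + 7) * (3 * p) ^ 2 <=
    2 * max_percolation_time D.+1 n.+1 + 16 * p + 30 * p * D.
Proof.
move=> np; have [->|] := posnP D; first by lia.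
move=> D0; have alt := alternating_schedule D p D.
have le := duration_le_max_percolation_time (D0 : 1 < D.+1) (proj1 (andP alt))
  (roomy_schedule np D0 (leqnn D)).
have := duration_schedule np D0; lia.
Qed.

Unset Implicit Arguments.
Set Strict Implicit.

From mathcomp Require Import boolp classical_sets reals topology normedtype landau.
Import Order.TTheory GRing.Theory Num.Theory numFieldNormedType.Exports.
Local Open Scope classical_set_scope.
Local Open Scope ring_scope.

Lemma linear_bigO (R : realType) (c : R) :
  (fun n : nat => c * n%:R) =O_\oo (fun n : nat => n%:R : R).
Proof.
apply/eqO_exP; exists (`|c| + 1) => //; first by rewrite ltr_wpDl.
by apply: nearW => n /=; rewrite normrM ler_wpM2r // lerDl.
Qed.

Theorem theorem18 (R : realType) (d : nat) (d_ge1 : (1 <= d)%N) :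
  exists f g : nat -> R,
    [/\ f =O_\oo (fun n : nat => n%:R : R),
        g =O_\oo (fun n : nat => n%:R : R) &
        forall n : nat, (1 <= n)%N ->
          (6 * d%:R ^+ 2 - 5 * d%:R - 1) / 18 * n%:R ^+ 2 + f n
            <= (max_percolation_time d n)%:R
            <= d%:R ^+ 2 / 2 * n%:R ^+ 2 + g n].
Proof.
case: d d_ge1 => // D _.
pose K : R := D%:R * (6 * D%:R + 7).
have K0 : 0 <= K by rewrite mulr_ge0 ?addr_ge0 ?mulr_ge0 ?ler0n.
exists (fun n => - (2 * K + 8 + 15 * D%:R) * n%:R), (fun n => D.+1%:R / 2 * n%:R).
split; [exact: linear_bigO | exact: linear_bigO | case=> // n _].
have -> : (6 * D.+1%:R ^+ 2 - 5 * D.+1%:R - 1) = K :> R.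
  by rewrite /K -natr1; ring.
apply/andP; split; last first.
  have := @max_percolation_time_le D.+1 n.+1 isT.
  rewrite -pred_Sn => h.
  have {h} : (2 * max_percolation_time D.+1 n.+1 <= D.+1 * n.+1 * (D.+1 * n.+1).+1)%N.
    have := bin_ffact (D.+1 * n).+1 2; rewrite !ffactnS ffactn0 /=.
    move: h; set M := max_percolation_time _ _; rewrite (_ : 2`! = 2)%N //.
    set x := (D.+1 * n)%N; have : (x <= D.+1 * n.+1)%N by rewrite leq_mul2l leqnSn orbT.
    move: (D.+1 * n.+1)%N => y; nia.
  rewrite -(ler_nat R) -[(_ * _).+1]addn1 !natrM natrD natrM.
  move: (max_percolation_time _ _)%:R (D.+1%:R) (n.+1%:R) => M a b h.
  by lra.
have N0 : 0 <= (n.+1%:R : R) by [].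
have M0 : 0 <= ((max_percolation_time D.+1 n.+1)%:R : R) by [].
have D0 : 0 <= (D%:R : R) by [].
have [n3|n3] := ltnP n 3.
  have n3' : (n.+1%:R : R) <= 3 by rewrite ler_nat.
  move: (n.+1%:R : R) N0 n3' => N N0 n3'.
  have : K * N * N <= K * N * 3 by rewrite ler_wpM2l // mulr_ge0.
  have : 0 <= K * N by rewrite mulr_ge0.
  have : 0 <= D%:R * N by rewrite mulr_ge0.
  by nra.
pose p := ((n - 3) %/ 9)%N.
have np : (9 * p + 3 <= n)%N by have := leq_trunc_div (n - 3) 9; lia.
have pn : (n.+1 <= 9 * p + 12)%N.
  by have := divn_eq (n - 3) 9; have := ltn_mod (n - 3) 9; rewrite -/p; lia.
have h : K * (9 * p%:R ^+ 2) <=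
    2 * (max_percolation_time D.+1 n.+1)%:R + 16 * p%:R + 30 * p%:R * D%:R.
  rewrite /K -natrX -!natrM -!natrD -!natrM ler_nat.
  by have := max_percolation_time_ge D np; rewrite expnMn.
have {}np : 9 * p%:R <= (n.+1%:R : R) by rewrite -natrM ler_nat; lia.
have {}pn : (n.+1%:R : R) <= 9 * p%:R + 12 by rewrite -natrM -natrD ler_nat.
have p0 : 0 <= (p%:R : R) by [].
move: (max_percolation_time _ _)%:R (n.+1%:R) (p%:R) (D%:R : R) K
  K0 M0 N0 D0 h np pn p0 => M N P d K K0 M0 N0 D0 h np pn p0.
have dN : d * P <= d * N by rewrite ler_wpM2l //; lra.
have : (N - 9 * P) * (N + 9 * P) <= 12 * (2 * N) by apply: ler_pM; lra.
move=> /(ler_wpM2l K0) h2.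
have KN : 0 <= K * N by rewrite mulr_ge0.
have -> : K / 18 * N ^+ 2 =
    (K * ((N - 9 * P) * (N + 9 * P)) + 9 * (K * (9 * P ^+ 2))) / 18.
  by field.
by move: h2 h; move: (K * ((N - 9 * P) * _)) (K * (9 * P ^+ 2)) => X Y h2 h; lra.
Qed.
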